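(* Blink (as defined in the context) satisfies Representative Validity: in every execution, if some correct server triggers $\langle con.\mathrm{Decide}\mid v\rangle$ for some $v\in\mathbb B$, then at least $f+1$ correct servers triggered $\langle con.\mathrm{Propose}\mid v\rangle$.
   Context: **Model.** $f\ge 0$ is an integer; $\Pi$ is a fixed, commonly known set of $n=5f+1$ servers, of which at most $f$ are faulty (Byzantine: may behave arbitrarily and collude); the others are correct and follow the algorithm. Any two servers (including a server and itself) communicate via reliable, authenticated, FIFO links, with message delays bounded by an unknown constant $\Delta$. Event handlers execute atomically. $\mathbb B=\{\mathtt{True},\mathtt{False}\}$. **Binary Consensus** (instance $dep$): every correct server proposes one value via $\langle dep.\mathrm{Propose}\mid p\rangle$, $p\in\mathbb B$, and may trigger $\langle dep.\mathrm{Decide}\mid d\rangle$, $d\in\mathbb B$. Integrity: no correct server decides more than once. Agreement: no two correct servers decide different values. Termination: if every correct server proposes, every correct server eventually decides. Validity: a decided value was proposed by at least one correct server. **Blink** (instance $con$, built on one Binary Consensus instance $dep$). Every correct server triggers $\langle con.\mathrm{Propose}\mid\cdot\rangle$ exactly once. Each server keeps a map $suggestions$ from $\Pi$ to $\mathbb B$ (initially empty) and flags $proposed=decided=\mathtt{False}$. (i) Upon $\langle con.\mathrm{Propose}\mid v\rangle$: send $[\mathtt{Suggest},v]$ to every server. (ii) Upon delivering $[\mathtt{Suggest},v]$ from $\sigma\in\Pi$: set $suggestions[\sigma]=v$. (iii) Upon $|suggestions|\ge 4f+1$ (number of keys) and $proposed=\mathtt{False}$: pick $v$ with $|\{\pi: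 suggestions[\pi]=v\}|\ge 2f+1$, trigger $\langle dep.\mathrm{Propose}\mid v\rangle$, set $proposed=\mathtt{True}$. (iv) Upon existence of $v$ with $|\{\pi: suggestions[\pi]=v\}|\ge 4f+1$: if $decided=\mathtt{False}$, trigger $\langle con.\mathrm{Decide}\mid v\rangle$ and set $decided=\mathtt{True}$. (v) Upon $\langle dep.\mathrm{Decide}\mid v\rangle$: if $decided=\mathtt{False}$, trigger $\langle con.\mathrm{Decide}\mid v\rangle$ and set $decided=\mathtt{True}$. *)

(* Defs.v *)
From mathcomp Require Import all_boot all_order all_algebra.
From mathcomp Require Import reals.
Set Implicit Arguments.
Unset Strict Implicit.
Unset Printing Implicit Defensive.

(** [propose i p v] / [decide i p v]: server [p] triggers Propose / Decide with
    value [v] at position [i] of the history.  Positions are ordered, so "was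
    proposed" in Validity means "strictly earlier in the history".  The
    requirement that every correct server proposes is the premise of
    Termination only. *)
Record binary_consensus (server : finType) (faulty : {set server})
    (propose decide : nat -> server -> bool -> Prop) : Prop := BinaryConsensus {
  bc_integrity : forall p i j v w, p \notin faulty ->
    decide i p v -> decide j p w -> i = j;
  bc_agreement : forall p q i j v w, p \notin faulty -> q \notin faulty ->
    decide i p v -> decide j q w -> v = w;
  bc_termination :
    (forall p, p \notin faulty -> exists i v, propose i p v) ->
    forall p, p \notin faulty -> exists i v, decide i p v;
  bc_validity : forall p i v, p \notin faulty -> decide i p v ->
    exists q j, [/\ q \notin faulty, j < i & propose j q v] }.

Definition upd (I : finType) (T : Type) (g : {ffun I -> T}) (x : I) (a : T) :
  {ffun I -> T} := [ffun y => if y == x then a else g y].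

Section Blink.
Variables (f : nat) (server : finType).

(** [suggestions s = None] means that [s] is not a key of the map. *)
Record sstate := SState {
  suggestions : {ffun server -> option bool};
  proposed : bool;
  decided : bool }.

Definition sstate0 : sstate := SState [ffun=> None] false false.

Definition keys (st : sstate) : {set server} :=
  [set s | suggestions st s != None].
Definition supporters (st : sstate) (v : bool) : {set server} :=
  [set s | suggestions st s == Some v].

(** The five "upon" clauses.  The last two carry no data: they are triggered by
    a condition on the local state. *)
Inductive input :=
  | ConPropose of bool
  | DeliverSuggest of server & bool
  | DepDecide of bool
  | EnoughSuggestions
  | EnoughSupport.

(** What a handler triggers: [broadcast = Some v] sends [Suggest, v] to every
    server (including itself), the other two fields are the events
    <dep.Propose | v> and <con.Decide | v>. *)
Record output := Output {
  broadcast : option bool;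
  dep_propose : option bool;
  con_decide : option bool }.

Definition no_output : output := Output None None None.

Definition decide_output (st : sstate) (v : bool) : output :=
  if decided st then no_output else Output None None (Some v).

(** [handle st inp st' o]: in local state [st], the handler of [inp] can run,
    ending in [st'] and triggering [o].  It is a relation because the value
    picked upon [EnoughSuggestions] need not be unique. *)
Inductive handle (st : sstate) : input -> sstate -> output -> Prop :=
  | on_con_propose v :
      handle st (ConPropose v) st (Output (Some v) None None)
  | on_deliver s v :
      handle st (DeliverSuggest s v)
        (SState (upd (suggestions st) s (Some v)) (proposed st) (decided st))
        no_output
  | on_enough_suggestions v :
      4 * f + 1 <= #|keys st| -> proposed st = false ->
      2 * f + 1 <= #|supporters st v| ->
      handle st EnoughSuggestions
        (SState (suggestions st) true (decided st))
        (Output None (Some v) None)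
  | on_enough_support v :
      4 * f + 1 <= #|supporters st v| ->
      handle st EnoughSupport
        (SState (suggestions st) (proposed st) true) (decide_output st v)
  | on_dep_decide v :
      handle st (DepDecide v)
        (SState (suggestions st) (proposed st) true) (decide_output st v).

Variables (R : realType) (faulty : {set server}).

(** [links (s, p)] is the FIFO queue (oldest first) of messages in transit from
    [s] to [p].  Only [Suggest, v] messages have a handler, so the links
    carry just [v], together with the time at which it was sent.  The [local]
    state is only meaningful at correct servers. *)
Record config := Config {
  local : {ffun server -> sstate};
  links : {ffun server * server -> seq (R * bool)} }.

Definition config0 : config := Config [ffun=> sstate0] [ffun=> [::]].

Definition emit (t : R) (p : server) (o : output)
    (lk : {ffun server * server -> seq (R * bool)}) :=
  if broadcast o is Some v then
    [ffun e => if e.1 == p then rcons (lk e) (t, v) else lk e]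
  else lk.

(** [Handle p inp o]: the correct server [p] atomically runs the handler of
    [inp], triggering [o].  Faulty servers send anything to anyone on their own
    links, at any time; what they do with received messages is left open. *)
Inductive label :=
  | Handle of server & input & output
  | FaultySend of server & server & bool
  | FaultyReceive of server & server
  | Idle.

Definition is_deliver (inp : input) : bool :=
  if inp is DeliverSuggest _ _ then true else false.

Inductive step (t : R) (c : config) : label -> config -> Prop :=
  | step_deliver s p v t0 q st o :
      p \notin faulty -> links c (s, p) = (t0, v) :: q ->
      handle (local c p) (DeliverSuggest s v) st o ->
      step t c (Handle p (DeliverSuggest s v) o)
        (Config (upd (local c) p st) (emit t p o (upd (links c) (s, p) q)))
  | step_handle p inp st o :
      p \notin faulty -> ~~ is_deliver inp ->
      handle (local c p) inp st o ->
      step t c (Handle p inp o)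
        (Config (upd (local c) p st) (emit t p o (links c)))
  | step_faulty_send p r v :
      p \in faulty ->
      step t c (FaultySend p r v)
        (Config (local c)
                (upd (links c) (p, r) (rcons (links c (p, r)) (t, v))))
  | step_faulty_receive s p m q :
      p \in faulty -> links c (s, p) = m :: q ->
      step t c (FaultyReceive s p)
        (Config (local c) (upd (links c) (s, p) q))
  | step_idle : step t c Idle c.

(** Step [i] happens at real time [time i], bears [lab i] and leads from
    [conf i] to [conf i.+1]. *)
Record run := Run {
  conf : nat -> config;
  lab : nat -> label;
  time : nat -> R }.

Definition handles (x : run) (i : nat) (p : server) (inp : input) : Prop :=
  exists o, lab x i = Handle p inp o.

Definition con_proposes (x : run) (i : nat) (p : server) (v : bool) : Prop :=
  handles x i p (ConPropose v).
Definition con_decides (x : run) (i : nat) (p : server) (v : bool) : Prop :=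
  exists inp o, lab x i = Handle p inp o /\ con_decide o = Some v.
Definition dep_proposes (x : run) (i : nat) (p : server) (v : bool) : Prop :=
  exists inp o, lab x i = Handle p inp o /\ dep_propose o = Some v.
Definition dep_decides (x : run) (i : nat) (p : server) (v : bool) : Prop :=
  handles x i p (DepDecide v).

Definition enabled (st : sstate) (inp : input) : Prop :=
  exists st' o, handle st inp st' o.

(** Weak fairness: a handler that stays enabled forever is eventually run. *)
Definition fair (x : run) (inp : input) : Prop :=
  forall p i, p \notin faulty ->
    (forall j, i <= j -> enabled (local (conf x j) p) inp) ->
    exists2 j, i <= j & handles x j p inp.

(** [ex_delay] says that no message is still in transit later than [Delta]
    after it was sent; as [time] is unbounded, every message is delivered.
    Finite executions are continued by [Idle] steps. *)
Record blink_execution (Delta : R) (x : run) : Prop := BlinkExecution {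
  ex_init : conf x 0 = config0;
  ex_step : forall i, step (time x i) (conf x i) (lab x i) (conf x i.+1);
  ex_time_mono : forall i, (time x i <= time x i.+1)%R;
  ex_time_unbounded : forall T : R, exists i, (T < time x i)%R;
  ex_delay : forall i e t v, (t, v) \in links (conf x i) e ->
    (time x i <= t + Delta)%R;
  ex_con_propose : forall p, p \notin faulty ->
    exists! i, exists v, con_proposes x i p v;
  ex_fair_suggestions : fair x EnoughSuggestions;
  ex_fair_support : fair x EnoughSupport;
  ex_dep : binary_consensus faulty (dep_proposes x) (dep_decides x) }.

End Blink.

(* Main.v *)
(** Whoever decides [v] relies, directly or through the validity of [dep], on a
    server that once held at least [2f+1] suggestions of [v]; at most [f] of
    them come from faulty servers, and a suggestion of [v] from a correct
    server is there only because that server proposed [v] earlier. *)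
Require Import Defs.
From mathcomp Require Import all_boot all_order all_algebra.
From mathcomp Require Import reals.
From mathcomp Require Import zify.
Set Implicit Arguments.
Unset Strict Implicit.
Unset Printing Implicit Defensive.

Section Backing.
Variables (f : nat) (server : finType) (R : realType) (faulty : {set server}).

(** The clause on [links] makes the invariant inductive: a delivery moves a message from a queue
    into [suggestions]. [P] is left abstract so that it can grow along the run. *)
Definition backed (P : server -> bool -> Prop) (c : config server R) : Prop :=
  (forall s p t v, s \notin faulty -> (t, v) \in links c (s, p) -> P s v) /\
  (forall s p v, s \notin faulty ->
    suggestions (local c p) s = Some v -> P s v).

Lemma backed0 (P : server -> bool -> Prop) : backed P (config0 server R).
Proof. by split=> [s p t v _|s p v _]; rewrite !ffunE. Qed.

Lemma handle_broadcast (st st' : sstate server) inp o v :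
  handle f st inp st' o -> broadcast o = Some v -> inp = ConPropose server v.
Proof.
case=> //= [w [->]|w _|w] //; by rewrite /decide_output; case: ifP.
Qed.

Lemma handle_suggestions (st st' : sstate server) inp o :
  handle f st inp st' o -> ~~ is_deliver inp ->
  suggestions st' = suggestions st.
Proof. by case. Qed.

Lemma handle_dep_propose (st st' : sstate server) inp o v :
  handle f st inp st' o -> dep_propose o = Some v ->
  2 * f + 1 <= #|supporters st v|.
Proof.
case=> //= [w _ _ sup [<-] //|w _|w]; by rewrite /decide_output; case: ifP.
Qed.

(** The support of [4 * f + 1] behind a direct decision is weakened to [2 * f + 1], the bound that
    [handle_dep_propose] gives, so that one counting argument serves both routes. *)
Lemma handle_con_decide (st st' : sstate server) inp o v :
  handle f st inp st' o -> con_decide o = Some v ->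
  2 * f + 1 <= #|supporters st v| \/ inp = DepDecide server v.
Proof.
case=> //= w; rewrite /decide_output; case: ifP => //= _; last first.
  by case=> ->; right.
by move=> sup [<-]; left; lia.
Qed.

Lemma emit_mem (t : R) (p : server) o lk s r (t' : R) v :
  (t', v) \in emit t p o lk (s, r) ->
  (t', v) \in lk (s, r) \/ s = p /\ broadcast o = Some v.
Proof.
rewrite /emit; case: (broadcast o) => [w|]; last by left.
rewrite ffunE /=; case: eqP => [->|_]; last by left.
by rewrite mem_rcons inE => /orP[/eqP[_ ->]|]; [right|left].
Qed.

(** A correct server puts a message on its links only by handling [ConPropose], so this is the only
    kind of step at which [P'] has to exceed [P]. *)
Lemma step_backed (P P' : server -> bool -> Prop) t c l c' :
  (forall s v, P s v -> P' s v) ->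
  (forall s v o, l = Handle s (ConPropose server v) o -> P' s v) ->
  step f faulty t c l c' -> backed P c -> backed P' c'.
Proof.
move=> PP' new stp [Hl Hs]; case: stp new => /=.
- move=> s p v t0 q st o _ lk hd new.
  have Hq t' w : s \notin faulty -> (t', w) \in (t0, v) :: q -> P s w.
    by move=> cs; rewrite -lk; apply: Hl.
  split=> [s' p' t' w cs /emit_mem[]|s' p' w cs] /=.
  + rewrite ffunE; case: eqP => [[es _] qin|_ /(Hl _ _ _ _ cs)/PP' //].
    apply: PP'; rewrite es in cs *.
    by apply: (Hq t' w) => //; rewrite inE qin orbT.
  + by case=> -> /(handle_broadcast hd).
  + rewrite ffunE; case: eqP => [_|_ /(Hs _ _ _ cs)/PP' //].
    (* The one overwritten entry is that of the sender [s]; its new value was the head of the queue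
       from [s], hence is covered by [Hq]. *)
    inversion hd; subst => /=; rewrite ffunE; case: eqP => [es [<-]|_].
      apply: PP'; rewrite es in cs *.
      by apply: (Hq t0 v) => //; rewrite mem_head.
    by move/(Hs _ _ _ cs)/PP'.
- move=> p inp st o _ nd hd new.
  split=> [s' p' t' w cs /emit_mem[/(Hl _ _ _ _ cs)/PP' //|]|s' p' w cs] /=.
  + by case=> -> /(handle_broadcast hd) ei; apply: (new _ _ o); rewrite ei.
  + rewrite ffunE; case: eqP => [_|_ /(Hs _ _ _ cs)/PP' //].
    by rewrite (handle_suggestions hd nd) => /(Hs _ _ _ cs)/PP'.
- move=> p r v fp _.
  split=> [s' p' t' w cs|s' p' w cs /(Hs _ _ _ cs)/PP' //] /=.
  (* Authentication: a faulty server writes only to its own links, so the altered queue cannot start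
     at the correct server [s']. *)
  rewrite ffunE; case: eqP => [[es _]|_ /(Hl _ _ _ _ cs)/PP' //].
  by rewrite es fp in cs.
- move=> s p m q _ lk _.
  split=> [s' p' t' w cs|s' p' w cs /(Hs _ _ _ cs)/PP' //] /=.
  rewrite ffunE; case: eqP => [[es ep] qin|_ /(Hl _ _ _ _ cs)/PP' //].
  by apply: PP'; apply: (Hl _ p t') => //; rewrite es lk inE qin orbT.
- by move=> _; split=> [s' p' t' w cs /(Hl _ _ _ _ cs)/PP'
                       |s' p' w cs /(Hs _ _ _ cs)/PP'].
Qed.

Lemma step_handle_inv (t : R) c p inp o c' :
  step f faulty t c (Handle p inp o) c' ->
  exists st', handle f (local c p) inp st' o.
Proof. by move=> stp; inversion stp; subst; eexists; eassumption. Qed.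

(** The bound [j < i] is strict because [conf x i] is the configuration before step [i]; a proposal
    at step [i] counts from [i.+1] on. *)
Lemma execution_backed Delta (x : run server R) i :
  blink_execution f faulty Delta x ->
  backed (fun s v => exists2 j, j < i & con_proposes x j s v) (conf x i).
Proof.
move=> hx; elim: i => [|i IHi]; first by rewrite (ex_init hx); apply: backed0.
apply: step_backed (ex_step hx i) IHi => [s v [j ji]|s v o li].
  by exists j => //; apply: ltnW.
by exists i => //; exists o.
Qed.

Lemma supporters_proposed Delta (x : run server R) i p v :
  blink_execution f faulty Delta x -> #|faulty| <= f ->
  2 * f + 1 <= #|supporters (local (conf x i) p) v| ->
  exists S : {set server},
    [/\ S \subset ~: faulty, f + 1 <= #|S| &
        forall q, q \in S -> exists2 j, j < i & con_proposes x j q v].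
Proof.
move=> hx hf sup; exists (supporters (local (conf x i) p) v :\: faulty); split.
- by rewrite setDE subsetIr.
(* Removing at most [f] faulty servers from [2 * f + 1] supporters leaves at least [f + 1]. *)
- have := cardsID faulty (supporters (local (conf x i) p) v).
  have := subset_leq_card (subsetIr (supporters (local (conf x i) p) v) faulty).
  lia.
- move=> q; rewrite !inE => /andP[cq /eqP sq].
  by have [_ sugg] := execution_backed i hx; apply: sugg cq sq.
Qed.

End Backing.

Theorem theorem2 (R : realType) (f : nat) (server : finType)
    (hn : #|server| = 5 * f + 1) (faulty : {set server}) (hf : #|faulty| <= f)
    (Delta : R) (x : run server R) (hx : blink_execution f faulty Delta x)
    (p : server) (v : bool) (i : nat) :
  p \notin faulty -> con_decides x i p v ->
  exists S : {set server},
    [/\ S \subset ~: faulty, f + 1 <= #|S| &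
        forall q, q \in S -> exists2 j, j < i & con_proposes x j q v].
Proof.
move=> cp [inp [o [li dec]]].
have := ex_step hx i; rewrite li => /step_handle_inv[st' hd].
have [sup|einp] := handle_con_decide hd dec.
  exact: supporters_proposed hx hf sup.
have dd : dep_decides x i p v by exists o; rewrite -einp.
(* Validity of [dep] shifts the count to the proposer [q] and its state at the earlier step [j]; the
   proposals found there precede [j], hence also [i]. *)
have [q [j [_ ji [inp' [o' [lj prop]]]]]] := bc_validity (ex_dep hx) cp dd.
have := ex_step hx j; rewrite lj => /step_handle_inv[st'' hd'].
have sup := handle_dep_propose hd' prop.
have [S [Sc Sn SP]] := supporters_proposed hx hf sup.
exists S; split=> // s /SP[k kj pr]; exists k => //.
exact: ltn_trans ji.
Qed.
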